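(* Let $n,m\ge 2$ and let $F_n,F_m\colon I\to I$ be open piecewise monotone maps of $I=[0,1]$ with exactly $n-1$ and $m-1$ critical points, respectively. If $F_n\circ F_m^{-1}=F_m^{-1}\circ F_n$ (as set-valued functions on $I$), then $$\mathrm{Ent}(F_n\circ F_m^{-1})=\max\{\log(n),\log(m)\}.$$
   Context: A continuous map $f\colon I\to I$ is piecewise monotone if there are points $0=c_0<c_1<\cdots<c_N=1$ such that $f|_{[c_i,c_{i+1}]}$ is one-to-one for each $i$; the critical points of $f$ are the points of $(0,1)$ at which $f$ is not locally monotone. $f$ is open if $f(U)$ is open in $I$ for each open $U\subset I$. (Thus an open map with $n-1$ critical points maps each of the $n$ closed intervals between consecutive elements of $\{0,1\}\cup\{\text{critical points}\}$ homeomorphically onto $I$.) $F_n\circ F_m^{-1}$ is $x\mapsto F_n(F_m^{-1}(\{x\}))$ and $F_m^{-1}\circ F_n$ is $x\mapsto F_m^{-1}(\{F_n(x)\})$. Entropy of a set-valued function $F\colon X\to 2^X$ with closed graph on a compact metric space $(X,d_X)$, where $2^X$ is the set of non-empty closed subsets: an $n$-orbit is a tuple $(x_1,\ldots,x_n)$ with $x_{i+1}\in F(x_i)$ for $1\le i<n$; $Orb_n(F)$ is the set of $n$-orbits. $S\subset Orb_n(F)$ is $(n,\varepsilon)$-separated if for any two distinct elements $(x_i),(y_i)$ of $S$ there is $i$ with $d_X(x_i,y_i)>\varepsilon$. With $s_{n,\varepsilon}(F)$ the largest cardinality of an $(n,\varepsilon)$-separated set, $\mathrm{Ent}(F)=\lim_{\varepsilon\to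 0}\limsup_{n\to\infty}\frac1n\log s_{n,\varepsilon}(F)$. *)

(* Defs.v *)
From HB Require Import structures.
From mathcomp Require Import all_boot all_order all_algebra finmap.
From mathcomp Require Import all_classical all_reals all_analysis.

Set Implicit Arguments.
Unset Strict Implicit.
Unset Printing Implicit Defensive.

Import Order.TTheory GRing.Theory Num.Theory.
Import numFieldTopology.Exports numFieldNormedType.Exports.

Local Open Scope classical_set_scope.
Local Open Scope ring_scope.

(* The library declares this metric, `|y - x|, only for the alias R^o. *)
HB.instance Definition _ (R : realType) := Metric.copy R R^o.

(* A subset of a metric space, seen as a type, carries the restricted metric;
   the library only provides its pseudometric structure. *)
Section subtype_metric.
Context {R : realType} {X : metricType R} (A : set X).

Let dist (x y : A) : R := mdist (set_val x) (set_val y).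

Let dist_ge0 x y : 0 <= dist x y.
Proof. exact: mdist_ge0. Qed.

Let dist_positivity x y : dist x y = 0 -> x = y.
Proof. by move=> /mdist_positivity; exact: val_inj. Qed.

Let ballE (x : A) (d : R) : ball x d = [set y | dist x y < d].
Proof.
by apply/seteqP; split => y; rewrite /dist /ball/= /initial_ball ballEmdist.
Qed.

HB.instance Definition _ := PseudoMetric_isMetric.Build R A
  dist_ge0 dist_positivity ballE.

End subtype_metric.

Section entropy.
Context {R : realType} {X : metricType R}.
Implicit Type F : X -> set X.

Definition Orb F (n : nat) : set (n.-tuple X) :=
  [set x | forall i j : 'I_n, j = i.+1 :> nat -> F (tnth x i) (tnth x j)].
Arguments Orb F n : clear implicits.

Definition eps_separated (n : nat) (eps : R) (S : set (n.-tuple X)) : Prop :=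
  forall x y, S x -> S y -> x <> y ->
    exists i, eps < mdist (tnth x i) (tnth y i).

(* A supremum over finite sets: it is the largest cardinality when there is
   one, and +oo when separated sets can be arbitrarily large. *)
Definition sep_card F (n : nat) (eps : R) : \bar R :=
  ereal_sup [set (#|` S|)%:R%:E | S in
    [set S : {fset n.-tuple X} | [set` S] `<=` Orb F n /\
                                 eps_separated eps [set` S]]].

Definition Ent F : \bar R :=
  lim (limn_esup (fun n => (n%:R^-1)%:E * lne (sep_card F n eps))%E
       @[eps --> 0^'+]).

End entropy.

Definition unitI (R : realType) : set R := `[0, 1].
Arguments unitI R : clear implicits.

Section interval_maps.
Context {R : realType}.
Implicit Type f g : unitI R -> unitI R.

Definition piecewise_monotone f : Prop :=
  continuous f /\
  exists (N : nat) (c : nat -> unitI R),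
    [/\ val (c 0%N) = 0, val (c N) = 1,
        forall i, (i < N)%N -> val (c i) < val (c i.+1) &
        forall i, (i < N)%N ->
          {in [set x : unitI R | val (c i) <= val x <= val (c i.+1)] &,
            injective f}].

Definition monotone_on (V : set (unitI R)) f : Prop :=
  {in V &, forall x y, val x <= val y -> val (f x) <= val (f y)} \/
  {in V &, forall x y, val x <= val y -> val (f y) <= val (f x)}.

Definition locally_monotone f (x : unitI R) : Prop :=
  exists2 V, nbhs x V & monotone_on V f.

Definition critical f : set (unitI R) :=
  [set x | 0 < val x < 1 /\ ~ locally_monotone f x].

Definition open_map f : Prop := forall U, open U -> open (f @` U).

Definition set_comp_inv f g : unitI R -> set (unitI R) :=
  fun x => f @` (g @^-1` [set x]).

Definition set_inv_comp g f : unitI R -> set (unitI R) :=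
  fun x => g @^-1` [set f x].

End interval_maps.

(* Main.v *)
(* Write f = Fm and g = Fn. Commutation says that f g = g f and that every
   solution of f y = g x has the form x = f z, y = g z. Hence the orbits
   (x_0, ..., x_k) of the set-valued map are exactly the sequences
   x_i = f^(k-i) (g^i z) with z in I.
   A local extremum of an open map is 0 or 1, so f and g consist of m and n
   laps, monotone pieces from 0 to 1 or from 1 to 0, and f^a g^b consists of
   m^a n^b laps.
   Upper bound: sum over i the variation of z |-> f^(k-i) (g^i z) on [0, z].
   This nondecreasing function of z is at most (k+1) max(m,n)^k and increases
   by more than eps between two eps-separated orbits.
   Lower bound: every fibre of f^p contains m^p / 2 points that are eps_p-apart,
   one in every other lap, and the points y of the fibre over g^p x can be
   reached from x in p steps. This gives (m^p / 2)^q separated orbits of length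
   q p + 1; exchanging f and g reverses the orbits. *)
Require Import Defs.
From mathcomp Require Import all_boot all_order all_algebra finmap.
From mathcomp Require Import all_classical all_reals all_analysis.
From mathcomp Require Import ring lra zify.

Set Implicit Arguments.
Unset Strict Implicit.
Unset Printing Implicit Defensive.

Import Order.TTheory GRing.Theory Num.Theory.
Import numFieldTopology.Exports numFieldNormedType.Exports.

Local Open Scope classical_set_scope.
Local Open Scope ring_scope.


(** * Laps of a real function: composition, variation and fibres *)

Section laps.
Context {R : realType}.
Implicit Types (f g : R -> R) (a b c x y : R) (M N : nat).

Definition rising g a b : Prop :=
  [/\ a < b, g a = 0, g b = 1 &
      forall x y, a <= x -> x <= y -> y <= b -> g x <= g y].

Definition lap g a b : Prop := rising g a b \/ rising (fun x => 1 - g x) a b.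

(** The breakpoints stay hidden in the recursion, so concatenation, reflection and composition are
    inductions on the number of laps. *)
Fixpoint laps g M a b : Prop :=
  if M is M'.+1 then exists2 c, lap g a c & laps g M' c b else a = b.

Lemma lap_lt g a b : lap g a b -> a < b.
Proof. by move=> [] []. Qed.

Lemma laps_le g M a b : laps g M a b -> a <= b.
Proof.
elim: M a => [a /= ->//|M IH a [c /lap_lt ac /IH]].
exact: le_trans (ltW ac).
Qed.

Lemma laps_cat g M N a b c :
  laps g M a b -> laps g N b c -> laps g (M + N) a c.
Proof.
elim: M a => [a /= ->//|M IH a [d lad ldb] lbc] /=.
by exists d => //; apply: IH.
Qed.

Lemma lap_opp g a b : lap g a b -> lap (fun x => g (1 - x)) (1 - b) (1 - a).
Proof.
move=> [] [ab g0 g1 gm]; [right|left]; split => /=.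
- lra.
- by rewrite (_ : 1 - (1 - b) = b) ?g1 ?subrr//; lra.
- by rewrite (_ : 1 - (1 - a) = a) ?g0 ?subr0//; lra.
- move=> x y ? ? ?; have := gm (1 - y) (1 - x); lra.
- lra.
- by rewrite (_ : 1 - (1 - b) = b) ?g1 //; lra.
- by rewrite (_ : 1 - (1 - a) = a); lra.
- move=> x y ? ? ?; have := gm (1 - y) (1 - x); lra.
Qed.

(** Reflecting the outer function lets [laps_comp] treat a falling lap of the inner one as a rising
    lap. *)
Lemma laps_opp g M a b :
  laps g M a b -> laps (fun x => g (1 - x)) M (1 - b) (1 - a).
Proof.
elim: M a => [a /= ->//|M IH a [d lad ldb]]; rewrite -addn1.
apply: laps_cat (IH _ ldb) _; exists (1 - a) => //; exact: lap_opp.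
Qed.

Lemma lap_comp f g u v b d : lap f u v -> b < d -> g b = u -> g d = v ->
  (forall x y, b <= x -> x <= y -> y <= d -> g x <= g y) -> lap (f \o g) b d.
Proof.
move=> [] [uv f0 f1 fm] bd gb gd gm; [left|right]; split => //=;
  rewrite ?gb ?gd// => x y bx xy yd; apply: fm.
- by rewrite -gb gm// (le_trans xy).
- exact: gm.
- by rewrite -gd gm// (le_trans bx).
- by rewrite -gb gm// (le_trans xy).
- exact: gm.
- by rewrite -gd gm// (le_trans bx).
Qed.

(** The intermediate value theorem pulls each breakpoint of [f] back along [g]; the chosen preimage
    splits [b, c] into a piece over the first lap and a piece over the others. At least one lap is
    required, since zero laps would force [b = c]. *)
Lemma laps_comp_rising f g M u b c : continuous g -> laps f M.+1 u 1 ->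
  b < c -> g b = u -> g c = 1 ->
  (forall x y, b <= x -> x <= y -> y <= c -> g x <= g y) ->
  laps (f \o g) M.+1 b c.
Proof.
move=> gC; elim: M u b => [|M IH] u b.
  by move=> [d l /= d1] bc gb gc gm; subst d; exists c => //; exact:
    lap_comp l _ _ _ _.
move=> [v luv lv] bc gb gc gm.
have v1 : v < 1 by case: lv => w /lap_lt vw /laps_le; exact: lt_le_trans.
have uv := lap_lt luv.
have [| |d] := @IVT _ g b c v (ltW bc).
- exact: continuous_subspaceT.
- by rewrite gb gc ge_min le_max (ltW uv) (ltW v1) orbT.
rewrite in_itv /= => /andP[bd dc] gd.
have bd' : b < d by rewrite lt_neqAle bd andbT; apply/eqP => E; move: uv;
  rewrite -gb -gd E ltxx.
have dc' : d < c by rewrite lt_neqAle dc andbT; apply/eqP => E; move: v1;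
  rewrite -gc -gd E ltxx.
exists d.
  by apply: lap_comp luv _ _ _ _ => // x y bx xy yd; apply: gm => //; apply:
    le_trans dc.
by apply: IH lv _ _ _ _ => // x y dx xy yc; apply: gm => //; apply: le_trans dx.
Qed.

Lemma laps_comp f g M N a b : (0 < M)%N -> continuous g -> laps f M 0 1 ->
  laps g N a b -> laps (f \o g) (N * M) a b.
Proof.
case: M => // M _ gC lf; elim: N a => [//|N IH] a [c lac /IH]; rewrite mulSn.
apply: laps_cat; case: lac => -[ac ga gc gm].
  exact: laps_comp_rising gC lf ac ga gc gm.
(* On a falling lap of [g], reflecting both at the output of [g] and at the input of [f] leaves the
   composite unchanged and makes the inner function rise. *)
have -> : f \o g = (fun x => f (1 - x)) \o (fun x => 1 - g x).
  by apply/funext => x /=; congr f; lra.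
have lf' : laps (fun x => f (1 - x)) M.+1 0 1.
  by have := laps_opp lf; rewrite subrr subr0.
apply: laps_comp_rising lf' ac ga gc gm.
by move=> x; apply: continuousB; [exact: cst_continuous|exact: gC].
Qed.

(* Take for [h x] the total variation of [g] on [a, x]. *)
Lemma laps_variation g M a b : laps g M a b ->
  exists h : R -> R, [/\ forall x y, x <= y -> h x <= h y,
    forall x, 0 <= h x <= M%:R &
    forall x y, a <= x -> x <= y -> y <= b -> `|g x - g y| <= h y - h x].
Proof.
elim: M a => [a /= ->|M IH a [c lac lcb]].
  exists (fun=> 0); split=> [//|x|x y ax xy yb]; first by rewrite lexx.
  by rewrite (_ : x = y) ?subrr ?normr0//; lra.
have [h [hm hM hv]] := IH _ lcb.
have cb := laps_le lcb.
have [k [kM k1 kv ac]] : exists k : R -> R, [/\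
    forall x y, a <= x -> x <= y -> y <= c -> k x <= k y,
    k a = 0 /\ k c = 1,
    forall x y, a <= x -> x <= y -> y <= c -> `|g x - g y| <= k y - k x & a < c].
  case: lac => -[ac ga gc gm]; eexists; split.
  - exact: gm.
  - by [].
  - move=> x y ax xy yc; rewrite distrC ger0_norm ?subr_ge0//; exact: gm.
  - by [].
  - exact: gm.
  - by [].
  - by move=> x y ax xy yc; have := gm x y ax xy yc; rewrite ler_norml; lra.
  - by [].
case: k1 => k0 k1.
have kb x : a <= x -> x <= c -> 0 <= k x <= 1.
  by move=> ax xc; rewrite -{1}k0 -k1 !kM.
(* Past [c] the first lap contributes its full variation 1. The cut-off at [a] makes monotonicity
   and the bounds hold on the whole line. *)
exists (fun x => if x <= a then 0 else if x <= c then k x else 1 + h x); split.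
- move=> x y xy; case: (leP y a) => ya; first by rewrite (le_trans xy ya).
  case: (leP x a) => xa.
    by case: (leP y c) => yc; [have := kb y (ltW ya) yc|have := hM y]; lra.
  case: (leP y c) => yc; first by rewrite (le_trans xy yc) kM// ltW.
  by case: (leP x c) => xc; [have := kb x (ltW xa) xc;
    have := hM y|have := hm _ _ xy]; lra.
- move=> x; rewrite -natr1; have := hM x.
  case: (leP x a) => xa; first by lra.
  by case: (leP x c) => xc; [have := kb x (ltW xa) xc|]; lra.
- move=> x y ax xy yb.
  have kE z : a <= z -> z <= c -> (if z <= a then 0 else if z <= c then k z else
    1 + h z) = k z.
    by move=> az zc; rewrite zc; case: (leP z a) => // za; rewrite (_ :
      z = a) ?k0//; lra.
  have hE z : c < z -> (if z <= a then 0 else if z <= c then k z else 1 + h z) =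
    1 + h z.
    by move=> cz; rewrite leNgt (lt_trans ac cz) /= leNgt cz.
  have [xc|xc] : c < x \/ x <= c by case: leP; [right|left].
    by rewrite !hE ?(lt_le_trans xc)//; have := hv x y (ltW xc) xy yb; lra.
  rewrite (kE x)//; have [yc|yc] : y <= c \/ c < y by case: leP; [left|right].
    by rewrite (kE y) ?(le_trans ax)//; exact: kv.
  rewrite hE//; have := kv x c ax xc (lexx _); have := hv c y (lexx _) (ltW yc) yb.
  by have := hM c; have := ler_distD (g c) (g x) (g y); lra.
Qed.

Lemma lap_fiber g a b v : continuous g -> lap g a b -> 0 <= v <= 1 ->
  exists2 x, a <= x <= b & g x = v.
Proof.
move=> gC lab v01; have [| |x] := @IVT _ g a b v (ltW (lap_lt lab)).
- exact: continuous_subspaceT.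
- by case: lab => -[_ ga gb _]; rewrite ge_min le_max; apply/andP; split;
    apply/orP; [left|right|right|left]; lra.
- by rewrite in_itv /= => xab gx; exists x.
Qed.

(* Adjacent laps share an endpoint, so only every other one is used. *)
Lemma laps_fiber g M a b : continuous g -> laps g M a b ->
  exists2 e, 0 < e & forall v, 0 <= v <= 1 ->
    exists s : seq R, [/\ size s = M./2,
      forall x, x \in s -> a <= x <= b, forall x, x \in s -> g x = v &
      pairwise (fun x y => e < `|x - y|) s].
Proof.
move=> gC; elim/ltn_ind: M a => -[|[|M]] IH a lab; try by exists 1 => // v _;
  exists [::].
case: lab => c lac [d lcd ldb].
have [e e0 he] := IH M (leqW (leqnn _)) _ ldb.
have [ac cd db] := And3 (lap_lt lac) (lap_lt lcd) (laps_le ldb).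
(* The new point lies left of [c] and the others right of [d]; halving the width of the skipped lap
   makes the inequality strict. *)
exists (Num.min e ((d - c) / 2)) => [|v v01].
  by rewrite lt_min e0; lra.
have [x xac gx] := lap_fiber gC lac v01.
have [s [ss sdb sv sp]] := he v v01; exists (x :: s); split.
- by rewrite /= ss.
- by move=> y; rewrite inE => /predU1P[->|/sdb]; lra.
- by move=> y; rewrite inE => /predU1P[->|/sv].
- rewrite /=; apply/andP; split.
    apply/allP => y /sdb yd; rewrite gt_min; apply/orP; right.
    by rewrite lter_normr; apply/orP; right; lra.
  by apply: sub_pairwise sp => y z; rewrite gt_min => ->.
Qed.

End laps.

(** * Open maps of the interval and their decomposition into laps *)

Section open_interval_maps.
Context {R : realType}.
Local Notation I := (unitI R).

Lemma val_unitI (x : I) : 0 <= val x <= 1.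
Proof. by have : val x \in `[0, 1] := set_valP x; rewrite in_itv. Qed.

Definition retract01 (x : R) : R := Num.max 0 (Num.min 1 x).

Lemma retract01_in x : retract01 x \in unitI R.
Proof.
apply/mem_set; suff : retract01 x \in `[0, 1] by [].
rewrite in_itv /= /retract01 le_max lexx /=.
by rewrite ge_max ler01 ge_min lexx.
Qed.

Definition to_unitI (x : R) : I := exist _ (retract01 x) (retract01_in x).

Lemma to_unitIK (x : R) : 0 <= x <= 1 -> val (to_unitI x) = x.
Proof.
by move=> /andP[x0 x1] /=; rewrite /retract01 (min_idPr x1) (max_idPr x0).
Qed.

Lemma val_to_unitI (x : I) : to_unitI (val x) = x.
Proof. by apply: val_inj; rewrite to_unitIK// val_unitI. Qed.

Lemma retract01_continuous : continuous retract01.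
Proof.
move=> x.
apply: (@continuous_max R R (cst 0) ((cst 1 : R -> R^o) \min id) x).
  exact: cst_continuous.
by apply: continuous_min; [exact: cst_continuous|exact: cvg_id].
Qed.

Lemma to_unitI_continuous : continuous to_unitI.
Proof.
apply: (@continuous_comp_initial _ _ _ (set_val : I -> R)).
exact: retract01_continuous.
Qed.

(** Clamping the argument to [0, 1] gives a function on the whole line, continuous if [f] is, to
    which the theorems of real analysis apply directly. *)
Definition extend (f : I -> I) : R -> R := fun x => val (f (to_unitI x)).

Lemma extend_val f (x : I) : extend f (val x) = val (f x).
Proof. by rewrite /extend val_to_unitI. Qed.

Lemma extend01 f x : 0 <= extend f x <= 1.
Proof. exact: val_unitI. Qed.

Lemma extend_comp f g : extend (f \o g) = extend f \o extend g.
Proof. by apply/funext => x; rewrite /= extend_val. Qed.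

Lemma extend_continuous f : continuous f -> continuous (extend f).
Proof.
move=> fC x; apply: (@continuous_comp _ _ _ (f \o to_unitI) (set_val : I -> R)).
  by apply: continuous_comp; [exact: to_unitI_continuous|exact: fC].
exact: initial_continuous.
Qed.

Variable f : I -> I.
Hypotheses (fC : continuous f) (fO : open_map f).
Let G := extend f.
Let GC : continuous G := extend_continuous fC.

(** The only values that an open map of I can take at a local extremum. *)
Definition endval (y : R) : Prop := y = 0 \/ y = 1.

(** Openness is relative to I, so [x] may be 0 or 1. This is what later makes the endpoints count as
    local extrema. *)
Lemma open_map_image a b x : 0 <= x <= 1 -> a < x < b ->
  exists2 e, 0 < e & forall t, 0 <= t <= 1 -> `|t - G x| < e ->
    exists2 z, (0 <= z <= 1) && (a < z < b) & G z = t.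
Proof.
move=> x01 axb; pose U : set I := set_val @^-1` `]a, b[.
have /fO[W Wo WU] : open U by exists `]a, b[%classic => //; exact: itv_open.
have Wx : W (G x).
  suff : (set_val @^-1` W) (f (to_unitI x)) by [].
  rewrite WU; exists (to_unitI x) => //.
  suff : val (to_unitI x) \in `]a, b[ by [].
  by rewrite to_unitIK// in_itv.
have /nbhs_ballP[e /= e0 eW] := open_nbhs_nbhs (conj Wo Wx).
exists e => // t t01 tG.
have : (set_val @^-1` W) (to_unitI t).
  suff : W (val (to_unitI t)) by [].
  by rewrite to_unitIK//; apply: eW; rewrite /ball /= distrC.
rewrite WU => -[z Uz zt]; exists (val z).
  by have : val z \in `]a, b[ by []; rewrite in_itv val_unitI.
by rewrite /G extend_val zt to_unitIK.
Qed.

(** If the maximum were below 1, openness would produce slightly larger values nearby. *)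
Lemma open_map_max a b x : 0 <= x <= 1 -> a < x < b ->
  (forall y, 0 <= y <= 1 -> a < y < b -> G y <= G x) -> G x = 1.
Proof.
move=> x01 axb xmax; have /andP[G0 G1] := extend01 f x.
apply: contrapT => /eqP Gn1; have {G1 Gn1}G1 : G x < 1 by rewrite lt_neqAle Gn1.
have [e e0 he] := open_map_image x01 axb.
pose d := Num.min (e / 2) (1 - G x).
have d0 : 0 < d by rewrite lt_min; lra.
have [de d1] : d <= e / 2 /\ d <= 1 - G x by rewrite !ge_min !lexx orbT.
have [||z /andP[z01 azb] Gz] := he (G x + d).
- by rewrite -/G in G0 *; lra.
- by rewrite addrAC subrr add0r gtr0_norm//; lra.
- by have := xmax z z01 azb; rewrite Gz; lra.
Qed.

Lemma open_map_min a b x : 0 <= x <= 1 -> a < x < b ->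
  (forall y, 0 <= y <= 1 -> a < y < b -> G x <= G y) -> G x = 0.
Proof.
move=> x01 axb xmin; have /andP[G0 G1] := extend01 f x.
apply: contrapT => /eqP Gn0.
have {G0 Gn0}G0 : 0 < G x by rewrite lt_neqAle eq_sym Gn0.
have [e e0 he] := open_map_image x01 axb.
pose d := Num.min (e / 2) (G x).
have d0 : 0 < d by rewrite lt_min; lra.
have [de d1] : d <= e / 2 /\ d <= G x by rewrite !ge_min !lexx orbT.
have [||z /andP[z01 azb] Gz] := he (G x - d).
- by rewrite -/G in G1 *; lra.
- by rewrite addrAC subrr add0r normrN gtr0_norm//; lra.
- by have := xmin z z01 azb; rewrite Gz; lra.
Qed.

(** If the maximum or the minimum over [x, y] differs from [G x], it is attained inside and is a
    local extremum. Otherwise [G] is constant there and the midpoint serves. *)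
Lemma open_map_rolle x y : 0 <= x -> x < y -> y <= 1 -> G x = G y ->
  exists2 z, x < z < y & endval (G z).
Proof.
move=> x0 xy y1 Gxy.
have GCxy : {within `[x, y], continuous G} by exact: continuous_subspaceT.
have [p pxy pmax] := EVT_max (ltW xy) GCxy.
have [q qxy qmin] := EVT_min (ltW xy) GCxy.
have inn z : z \in `[x, y] -> G z <> G x -> x < z < y.
  rewrite in_itv /= => /andP[xz zy] zx; rewrite !lt_neqAle xz zy !andbT.
  by apply/andP; split; apply/eqP => E; apply: zx; rewrite E // Gxy.
have maxval z : x < z < y -> G z = G p -> G z = 1.
  move=> xzy zp; apply: (@open_map_max x y) => // [|t t01 xty]; first by lra.
  by rewrite zp pmax// in_itv /=; lra.
have [px|px] := pselect (G p = G x); last first.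
  by have xpy := inn p pxy px; exists p => //; right; exact: maxval.
have [qx|qx] := pselect (G q = G x); last first.
  have xqy := inn q qxy qx; exists q => //; left.
  apply: (@open_map_min x y) => // [|t t01 xty]; first by lra.
  by rewrite qmin// in_itv /=; lra.
have mxy : x < (x + y) / 2 < y by lra.
exists ((x + y) / 2) => //; right; apply: maxval => //; apply/eqP.
rewrite eq_le pmax ?in_itv /= ?px -?qx ?qmin ?in_itv //=; lra.
Qed.

(** By [open_map_rolle], [G] is injective on [a, b], and a continuous injective function on an
    interval is strictly monotone. *)
Lemma open_map_strict_mono a b : 0 <= a -> b <= 1 ->
  (forall z, a < z < b -> ~ endval (G z)) ->
  (forall x y, a <= x -> x < y -> y <= b -> G x < G y) \/
  (forall x y, a <= x -> x < y -> y <= b -> G y < G x).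
Proof.
move=> a0 b1 nz.
have aux x y : a <= x -> x < y -> y <= b -> G x <> G y.
  move=> ax xy yb Gxy.
  have [z xzy] := open_map_rolle (le_trans a0 ax) xy (le_trans yb b1) Gxy.
  by apply: nz; lra.
have Ginj : {in `[a, b] &, injective G}.
  move=> x y; rewrite !in_itv /= => /andP[ax xb] /andP[ay yb] Gxy.
  have [xy|xy|//] := ltgtP x y; first by case: (aux x y).
  by case: (aux y x).
have [|Gm|Gm] := @itv_continuous_inj_mono _ G `[a, b] _ Ginj.
- exact: continuous_subspaceT.
- by left=> x y ax xy yb; apply: Gm => //; rewrite in_itv /=; lra.
- by right=> x y ax xy yb; apply: Gm => //; rewrite in_itv /=; lra.
Qed.

Lemma near_not_endval x : ~ endval (G x) ->
  exists2 e, 0 < e & forall y, `|y - x| < e -> ~ endval (G y).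
Proof.
move=> nx.
have /nbhs_ballP[e /= e0 he] : \forall y \near x, ~ endval (G y).
  have G01 : 0 < G x < 1.
    have /andP[G0 G1] := extend01 f x; rewrite !lt_neqAle G0 G1 !andbT.
    by apply/andP; split; apply/eqP => E; apply: nx; [left|right].
  have G01' : G x \in `]0, 1[ by rewrite in_itv.
  have Gn := near_in_itvoo G01'.
  apply: (@filterS _ (nbhs x) _ (G @^-1` [set t | t \in `]0, 1[])); last exact:
    (GC Gn).
  by move=> y /=; rewrite in_itv /= => yG [] yE; move: yG; rewrite yE; lra.
by exists e => // y ye; apply: he; rewrite /ball /= distrC.
Qed.

(** Otherwise [G] avoids 0 and 1 near [x], so it is strictly monotone on a one-sided interval at
    [x]; relative to I, [x] is then a local extremum. *)
Lemma open_map_endpoint x : x = 0 \/ x = 1 -> endval (G x).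
Proof.
move=> xe; apply: contrapT => nx; have [e e0 he] := near_not_endval nx.
pose d := Num.min (e / 2) 1.
have d0 : 0 < d by rewrite lt_min; lra.
have [de d1] : d <= e / 2 /\ d <= 1 by rewrite !ge_min !lexx orbT.
have he' z : x - d <= z <= x + d -> ~ endval (G z).
  by move=> xz; apply: he; rewrite ltr_norml; lra.
apply: nx.
(* [a, b] is [0, d] or [1 - d, 1] and contains every point of I at distance less than [d] from
   [x]. *)
have [a [b [xab a0 b1 abd [xa xb]]]] : exists a b, [/\ a <= x <= b, 0 <= a, b <= 1,
    x - d <= a /\ b <= x + d & (forall y,
      0 <= y <= 1 -> x - d < y < x + d -> a <= y <= b) /\ (x = a \/ x = b)].
  by case: xe => xE; [exists 0, d|exists (1 - d), 1]; split; try lra; split;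
    try lra; try (by [left|right]); move=> *; lra.
have x01 : 0 <= x <= 1 by lra.
have xd : x - d < x < x + d by lra.
have [|Gm|Gm] := @open_map_strict_mono a b a0 b1.
- by move=> z az; apply: he'; lra.
- have Gw u v : a <= u -> u <= v -> v <= b -> G u <= G v.
    by rewrite [u <= v]le_eqVlt => au /predU1P[->//|uv] vb; apply/ltW/Gm.
  case: xb => xE; [left; apply: (open_map_min x01 xd)|right; apply:
    (open_map_max x01 xd)].
    by move=> y y01 /(xa _ y01) yab; apply: Gw; lra.
  by move=> y y01 /(xa _ y01) yab; apply: Gw; lra.
- have Gw u v : a <= u -> u <= v -> v <= b -> G v <= G u.
    by rewrite [u <= v]le_eqVlt => au /predU1P[->//|uv] vb; apply/ltW/Gm.
  case: xb => xE; [right; apply: (open_map_max x01 xd)|left; apply: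
    (open_map_min x01 xd)].
    by move=> y y01 /(xa _ y01) yab; apply: Gw; lra.
  by move=> y y01 /(xa _ y01) yab; apply: Gw; lra.
Qed.

Lemma open_map_not_cst u v c : 0 <= u -> u < v -> v <= 1 ->
  ~ (forall y, u < y < v -> G y = c).
Proof.
move=> u0 uv v1 Gc; have m01 : 0 <= (u + v) / 2 <= 1 by lra.
have muv : u < (u + v) / 2 < v by lra.
have G1 : G ((u + v) / 2) = 1.
  by apply: (open_map_max m01 muv) => y _ yuv; rewrite !Gc.
have : G ((u + v) / 2) = 0.
  by apply: (open_map_min m01 muv) => y _ yuv; rewrite !Gc.
by rewrite G1; lra.
Qed.

(** Away from the values 0 and 1, [G] is locally strictly monotone. Conversely, a function that is
    monotone around a point where it takes an extreme value is constant on one side of it, which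
    [open_map_not_cst] excludes. *)
Lemma critical_open_map (p : I) :
  critical f p <-> 0 < val p < 1 /\ endval (G (val p)).
Proof.
split=> [[p01 np]|[p01 pe]]; split => //.
  apply: contrapT => nx; apply: np; have [e e0 he] := near_not_endval nx.
  exists [set y : I | `|val y - val p| < e].
    exists (set_val @^-1` ball (val p) e); split.
    - by exists (ball (val p) e) => //; exact: ball_open.
    - exact: ballxx.
    - by move=> y /=; rewrite /ball /= distrC.
  have [|||Gm|Gm] := @open_map_strict_mono (Num.max 0 (val p - e)) (Num.min 1
    (val p + e)).
  - by rewrite le_max lexx.
  - by rewrite ge_min lexx.
  - by move=> z; rewrite gt_max lt_min => zp; apply: he; rewrite ltr_norml; lra.
  - left=> x y xV yV; have xe : `|val x - val p| < e := set_mem xV.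
    have ye : `|val y - val p| < e := set_mem yV.
    move: xe ye; rewrite !ltr_norml => xe ye;
      rewrite le_eqVlt => /predU1P[/val_inj->//|xy].
    rewrite -(extend_val f x) -(extend_val f y); apply/ltW/Gm => //.
      by rewrite ge_max; have := val_unitI x; lra.
    by rewrite le_min; have := val_unitI y; lra.
  - right=> x y xV yV; have xe : `|val x - val p| < e := set_mem xV.
    have ye : `|val y - val p| < e := set_mem yV.
    move: xe ye; rewrite !ltr_norml => xe ye;
      rewrite le_eqVlt => /predU1P[/val_inj->//|xy].
    rewrite -(extend_val f x) -(extend_val f y); apply/ltW/Gm => //.
      by rewrite ge_max; have := val_unitI x; lra.
    by rewrite le_min; have := val_unitI y; lra.
case=> V [_ [[W' W'o <-] W'p WV]] Vm.
have /nbhs_ballP[e /= e0 eW] := open_nbhs_nbhs (conj W'o W'p).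
pose d := Num.min e (Num.min (val p) (1 - val p)).
have d0 : 0 < d by rewrite !lt_min; lra.
have [de [dp d1]] : d <= e /\ d <= val p /\ d <= 1 - val p.
  by rewrite !ge_min !lexx !orbT.
have Vy y : val p - d < y < val p + d -> to_unitI y \in V /\ val (to_unitI y) = y.
  move=> yd; have yE : val (to_unitI y) = y by rewrite to_unitIK//; lra.
  split=> //; apply/mem_set/WV; suff : W' (val (to_unitI y)) by [].
  rewrite yE; apply: eW; suff : `|val p - y| < e by [].
  by rewrite ltr_norml; lra.
have left_side : ~ exists c, forall y, val p - d < y < val p -> G y = c.
  by case=> c; apply: open_map_not_cst; lra.
have right_side : ~ exists c, forall y, val p < y < val p + d -> G y = c.
  by case=> c; apply: open_map_not_cst; lra.
have G01 y : 0 <= G y <= 1 by exact: extend01.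
case: Vm => Vm.
  have Gm u v : val p - d < u -> u <= v -> v < val p + d -> G u <= G v.
    move=> pu uv vp; have [|uV uE] := Vy u; first by lra.
    by have [|vV vE] := Vy v; [lra|apply: (Vm _ _ uV vV); rewrite uE vE].
  case: pe => pe; [apply: left_side; exists 0|apply: right_side; exists 1] => y yp.
    by have := Gm y (val p); have := G01 y; rewrite pe; lra.
  by have := Gm (val p) y; have := G01 y; rewrite pe; lra.
have Gm u v : val p - d < u -> u <= v -> v < val p + d -> G v <= G u.
  move=> pu uv vp; have [|uV uE] := Vy u; first by lra.
  by have [|vV vE] := Vy v; [lra|apply: (Vm _ _ uV vV); rewrite uE vE].
case: pe => pe; [apply: right_side; exists 0|apply: left_side; exists 1] => y yp.
  by have := Gm (val p) y; have := G01 y; rewrite pe; lra.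
by have := Gm y (val p); have := G01 y; rewrite pe; lra.
Qed.

Lemma open_map_lap a b : 0 <= a -> a < b -> b <= 1 ->
  endval (G a) -> endval (G b) -> (forall z, a < z < b -> ~ endval (G z)) ->
  lap G a b.
Proof.
move=> a0 ab b1 ea eb nz.
have [Gm|Gm] := open_map_strict_mono a0 b1 nz; have := Gm a b (lexx _) ab (lexx _).
- case: ea eb => ea [] eb; rewrite ea eb ?ltxx ?ltr10 // => _; left;
  split=> // x y ax.
  by rewrite [x <= y]le_eqVlt => /predU1P[->//|xy] yb; apply/ltW/Gm.
- case: ea eb => ea [] eb; rewrite ea eb ?ltxx ?ltr10 // => _; right; split=> //.
  + by rewrite ea subrr.
  + by rewrite eb subr0.
  + move=> x y ax; rewrite [x <= y]le_eqVlt => /predU1P[->//|xy] yb.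
    by rewrite lerD2l lerN2; apply/ltW/Gm.
Qed.

(** [l] holds the breakpoints beyond [a]. The left end is left general for the induction: after the
    lap ending at the head [c], the tail holds the breakpoints beyond [c]. *)
Lemma open_map_laps_from l a : 0 <= a -> a < 1 -> endval (G a) -> sorted <%R l ->
  (forall z, z \in l <-> a < z < 1 /\ endval (G z)) -> laps G (size l).+1 a 1.
Proof.
have e1 : endval (G 1) by apply: open_map_endpoint; right.
elim: l a => [|c l IH] a a0 a1 ea sl al.
  exists 1 => //; apply: open_map_lap => // z az ez.
  by have := (al z).2 (conj az ez).
have [ac1 ec] := (al c).1 (mem_head _ _).
have /andP[ac c1] := ac1.
have /andP[/allP cl sl'] : all (> c) l && sorted <%R l.
  by rewrite -path_sortedE //; exact: lt_trans.
exists c.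
  apply: open_map_lap => //; first exact: ltW.
  move=> z /andP[az zc] ez; have : z \in c :: l.
    by apply/al; split=> //; rewrite az (lt_trans zc).
  by rewrite inE => /predU1P[zE|/cl]; [move: zc;
    rewrite zE ltxx|rewrite ltNge (ltW zc)].
apply: IH => //; first exact: ltW (le_lt_trans a0 ac).
move=> z; split=> [zl|[/andP[cz z1] ez]].
  have [/andP[_ z1] ez] : a < z < 1 /\ endval (G z) by apply/al;
    rewrite inE zl orbT.
  by rewrite cl.
have : z \in c :: l by apply/al; split=> //; rewrite z1 (lt_trans ac).
by rewrite inE => /predU1P[zE|//]; move: cz; rewrite zE ltxx.
Qed.

Lemma open_map_laps m : (0 < m)%N -> (critical f #= `I_m.-1)%card -> laps G m 0 1.
Proof.
move=> m0 cm.
have cfin : finite_set (critical f) by exists m.-1.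
pose l := sort <=%R [seq val x | x <- fset_set (critical f)].
have -> : m = (size l).+1.
  by rewrite size_sort size_map -[size _]/(#|` fset_set (critical f)|)
    (card_fset_set cm) prednK.
apply: open_map_laps_from => //.
- by apply: open_map_endpoint; left.
- rewrite lt_sorted_uniq_le sort_uniq map_inj_uniq ?fset_uniq; last exact: val_inj.
  by apply: sort_sorted; exact: le_total.
- move=> z; rewrite mem_sort; split.
    move=> /mapP[x]; rewrite in_fset_set// => /set_mem xc ->.
    exact/critical_open_map.
  move=> [z01 ez]; have zE : val (to_unitI z) = z by rewrite to_unitIK//; lra.
  apply/mapP; exists (to_unitI z) => //; rewrite in_fset_set//; apply/mem_set.
  by apply/critical_open_map; rewrite zE.
Qed.

End open_interval_maps.

(** * Entropy from exponential bounds on separated sets *)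

Section entropy_bounds.
Context {R : realType}.

Lemma limn_esup_le (u : (\bar R)^nat) (c : \bar R) :
  (\forall k \near \oo, u k <= c)%E -> (limn_esup u <= c)%E.
Proof.
move=> [N _ uc]; apply: (@le_trans _ _ (ereal_sup (u @` [set k | (N <= k)%N]))).
  by apply: ereal_inf_lbound; exists [set k | (N <= k)%N] => //; exists N.
by apply: ge_ereal_sup => _ [k Nk <-]; exact: uc.
Qed.

Lemma le_limn_esup (u : (\bar R)^nat) (c : \bar R) :
  (forall N, exists2 k, (N <= k)%N & (c <= u k)%E) -> (c <= limn_esup u)%E.
Proof.
move=> cu; apply: le_ereal_inf_tmp => _ [A [N _ NA] <-].
have [k Nk ck] := cu N; apply: (le_trans ck).
by apply: ereal_sup_ubound; exists k => //; exact: NA.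
Qed.

Context {X : metricType R}.
Implicit Type F : X -> set X.

(** Since [0 <= e], separated orbits are distinct tuples, so the family indexed by [T] keeps its
    cardinality. *)
Lemma le_sep_card F k e (T : finType) (o : T -> nat -> X) :
  0 <= e -> (forall t i, (i.+1 < k)%N -> F (o t i) (o t i.+1)) ->
  (forall s t, s != t -> exists2 i, (i < k)%N & e < mdist (o s i) (o t i)) ->
  (#|T|%:R%:E <= sep_card F k e)%E.
Proof.
move=> e0 oF osep; pose g t : k.-tuple X := [tuple o t i | i < k].
have gE t i : tnth (g t) i = o t i by rewrite tnth_mktuple.
have gne s t : s != t -> exists i : 'I_k, e < mdist (tnth (g s) i) (tnth (g t) i).
  by move=> /osep[i ik h]; exists (Ordinal ik); rewrite !gE.
have ginj : injective g.
  move=> s t st; apply/eqP/negPn/negP => /gne[i]; by rewrite st mdistxx ltNge e0.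
rewrite /sep_card; apply: ereal_sup_ubound; exists [fset g t | t in T]%fset;
  last first.
  by rewrite card_imfset //= cardE.
split=> [x /= /imfsetP[t _ ->] i j ji|x y /= /imfsetP[s _ ->] /imfsetP[t _ ->] st].
  by rewrite !gE ji; apply: oF; rewrite -ji.
by apply: gne; apply: contra_notN st => /eqP->.
Qed.

Lemma sep_card_le F k e (C : R) :
  (forall (s : seq (k.-tuple X)), uniq s -> (forall x, x \in s -> Orb F x) ->
    (forall x y, x \in s -> y \in s -> x != y ->
       exists i, e < mdist (tnth x i) (tnth y i)) -> (size s)%:R <= C) ->
  (sep_card F k e <= C%:E)%E.
Proof.
move=> sC; rewrite /sep_card; apply: ge_ereal_sup => _ [S [SF Ssep] <-];
  rewrite lee_fin.
apply: sC => [|x xS|x y xS yS xy]; first exact: fset_uniq.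
  exact: SF.
by apply: Ssep => //; exact/eqP.
Qed.

Lemma sep_card_antitone F k e e' : e <= e' ->
  (sep_card F k e' <= sep_card F k e)%E.
Proof.
move=> ee'; apply: ereal_sup_le => _ [S [SF Ssep] <-]; exists S => //; split=> //.
by move=> x y Sx Sy xy; have [i] := Ssep x y Sx Sy xy; exists i; exact:
  le_lt_trans ee' _.
Qed.

Lemma sep_card_ge0 F k e : (0 <= sep_card F k e)%E.
Proof.
rewrite /sep_card; apply: ereal_sup_ubound; by exists fset0.
Qed.

(** Only the exponential rate matters: [C] may depend on [e] and [d], and in the lower bound it is
    enough to have one scale [e] for each [d] and infinitely many lengths. *)
Lemma Ent_eq F (L : R) :
  (forall e, 0 < e -> forall d, 0 < d -> exists2 C, 0 < C & forall k,
     (sep_card F k e <= (C * expR ((L + d) * k%:R))%:E)%E) ->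
  (forall d, 0 < d -> exists2 e, 0 < e & forall N, exists2 k, (N <= k)%N &
     ((expR ((L - d) * k%:R))%:E <= sep_card F k e)%E) ->
  Ent F = L%:E.
Proof.
move=> up lo; set u := fun e k => ((k%:R^-1)%:E * lne (sep_card F k e))%E.
have upe e : 0 < e -> (limn_esup (u e) <= L%:E)%E.
  move=> e0; apply/lee_addgt0Pr => d d0.
  (* One half of [d] goes into the exponent, the other absorbs [ln C / k] for large [k]. *)
  have d20 : 0 < d / 2 by rewrite divr_gt0.
  have [C C0 hC] := up e e0 (d / 2) d20.
  apply: limn_esup_le; near=> k; have k0 : 0 < k%:R :> R by rewrite ltr0n; near:
    k; exists 1%N.
  have kC : ln C <= d / 2 * k%:R.
    rewrite -ler_pdivrMl ?divr_gt0//; near: k; exact: nbhs_infty_ger.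
  rewrite /u muleC lee_pdivrMr//.
  apply: (@le_trans _ _ (lne (C * expR ((L + d / 2) * k%:R))%:E)).
    rewrite lee_lne// in_itv /= leey andbT ?sep_card_ge0//.
    by rewrite lee_fin mulr_ge0 ?ltW ?expR_gt0.
  rewrite lne_EFin ?mulr_gt0 ?expR_gt0// lee_fin lnM ?posrE ?expR_gt0// expRK.
  lra.
have loe d : 0 < d -> exists2 e, 0 < e & forall e',
  e' <= e -> (L%:E - d%:E <= limn_esup (u e'))%E.
  move=> d0; have [e e0 he] := lo d d0; exists e => // e' e'e.
  apply: le_limn_esup => N; have [k Nk hk] := he N.+1; exists k; first exact: ltnW.
  have k0 : 0 < k%:R :> R by rewrite ltr0n (leq_trans _ Nk).
  have hk' := le_trans hk (sep_card_antitone F k e'e).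
  rewrite /u muleC lee_pdivlMr// -EFinB -EFinM.
  have -> : ((L - d) * k%:R)%:E = lne (expR ((L - d) * k%:R))%:E.
    by rewrite lne_EFin ?expR_gt0// expRK.
  rewrite lee_lne// in_itv /= leey andbT ?lee_fin ?expR_ge0//.
  by apply: le_trans hk'; rewrite lee_fin expR_ge0.
have lnei e e' k : e <= e' -> (u e' k <= u e k)%E.
  move=> ee'; rewrite /u lee_wpmul2l ?lee_fin ?invr_ge0//.
  by rewrite lee_lne ?sep_card_antitone// in_itv /= leey andbT sep_card_ge0.
have unei : {in Interval (BRight 0) +oo%O &, nonincreasing_fun (fun e =>
  limn_esup (u e))}.
  move=> e e' _ _ ee'; apply: le_ereal_inf_tmp => _ [A AN <-].
  apply: (@le_trans _ _ (ereal_sup (u e' @` A))).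
    by apply: ereal_inf_lbound; exists A.
  apply: ge_ereal_sup => _ [k Ak <-]; apply: le_trans (lnei _ _ k ee') _.
  by apply: ereal_sup_ubound; exists k.
(* By monotonicity in [e], the limit at 0 from the right is the supremum over [e > 0]. *)
have := @nonincreasing_at_right_cvge R _ 0 +oo%O isT unei.
rewrite /Ent -/u => /cvg_lim -> //; apply/eqP; rewrite eq_le; apply/andP; split.
  apply: ge_ereal_sup => _ [e e0 <-]; apply: upe.
  by move: e0; rewrite /= in_itv /= andbT.
apply/lee_addgt0Pr => d d0; have [e e0 he] := loe d d0.
rewrite -leeBlDr//; apply: le_trans (he e (lexx _)) _.
by apply: ereal_sup_ubound; exists e; rewrite //= in_itv /= andbT.
Unshelve. all: by end_near. Qed.

End entropy_bounds.

(** * Orbits of a commuting pair with the lifting property *)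

Section orbits.
Context {T : Type} (f g : T -> T).
Hypotheses (fg : forall z, f (g z) = g (f z))
  (lift : forall x y, f y = g x -> exists2 z, f z = x & g z = y).

Lemma iter_comm a z : iter a f (g z) = g (iter a f z).
Proof. by elim: a => //= a ->. Qed.

(** Lifting squares are pasted into a rectangle: [lift1] builds one row of [a] squares, and the
    induction on [b] stacks the rows. *)
Lemma lift_iter a b x y : iter a f y = iter b g x ->
  exists2 z, iter a f z = x & iter b g z = y.
Proof.
have lift1 x' y' : iter a f y' = g x' -> exists2 z, iter a f z = x' & g z = y'.
  elim: a x' => [x' /= ->|a' IH x' /= /lift[z1 fz1 gz1]]; first by exists x'.
  by have [z fz gz] := IH _ (esym gz1); exists z => //=; rewrite fz.
elim: b y => [y|b IH y]; first by exists y.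
rewrite iterS => /lift1[z1 /IH[z fz gz] gz1].
by exists z => //=; rewrite gz.
Qed.

(* The lifts [y i] of the pairs [(x i, x i.+1)] form an orbit again, one step
   shorter. *)
Lemma orbit_iter k (x : nat -> T) :
  (forall i, (i < k)%N -> f (x i.+1) = g (x i)) ->
  exists z, forall i, (i <= k)%N -> x i = iter (k - i) f (iter i g z).
Proof.
elim: k x => [x _|k IH x xP]; first by exists (x 0%N) => -[].
have /choice[y yP] : forall i, exists y, (i < k.+1)%N -> f y = x i /\ g y = x i.+1.
  move=> i; have [ik|_] := boolP (i < k.+1)%N; last by exists (x 0%N).
  by have [y] := lift (xP i ik); exists y.
have [i ik|z zP] := IH y.
  by rewrite (yP i.+1 _).1 ?(yP i _).2// ltnW.
exists z => i; rewrite leq_eqVlt => /predU1P[->|ik].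
  by rewrite subnn /= -(yP k _).2// zP// subnn.
by rewrite -(yP i ik).1 zP// subSn.
Qed.

(** A common lift [z] supplies the intermediate points f^(p-i) (g^i z). *)
Lemma iter_path p x y : iter p f y = iter p g x -> exists o : nat -> T,
  [/\ o 0%N = x, o p = y & forall i, (i < p)%N -> f (o i.+1) = g (o i)].
Proof.
move=> /lift_iter[z fz gz]; exists (fun i => iter (p - i) f (iter i g z)); split.
- by rewrite subn0.
- by rewrite subnn.
- by move=> i ip; rewrite -iterS subnSK// -iter_comm.
Qed.

End orbits.

(** * Concatenation of labelled paths *)

(** [pa x l] is thought of as a path of [p] steps from [x] chosen by the label [l]. The paths named
    by the word [w] are followed in turn, each from the end of the previous one; a junction counts
    as index 0 of the next path. *)
Fixpoint walk {T L : Type} (p : nat) (pa : T -> L -> nat -> T) (w : seq L)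
    (x : T) (i : nat) : T :=
  if w is l :: w' then
    if (i < p)%N then pa x l i else walk p pa w' (pa x l p) (i - p)
  else x.

Section walks.
Context {T : Type} {L : eqType} (p : nat) (pa : T -> L -> nat -> T).
Hypotheses (p0 : (0 < p)%N) (pa0 : forall x l, pa x l 0 = x).

Lemma walk0 w x : walk p pa w x 0 = x.
Proof. by case: w => //= l w; rewrite p0 pa0. Qed.

Lemma walk_step (r : T -> T -> Prop) :
  (forall x l i, (i < p)%N -> r (pa x l i) (pa x l i.+1)) ->
  forall w x i, (i < size w * p)%N -> r (walk p pa w x i) (walk p pa w x i.+1).
Proof.
move=> par; elim=> [//|l w IH] x i; rewrite /= mulSn => iwp.
have [ip|pi] := ltnP i p; last first.
  by rewrite ltnNge leqW//= subSn//; apply: IH; rewrite ltn_subLR.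
have [ip'|] := ltnP i.+1 p; first exact: par.
(* Here [i.+1 = p]: the step reaches the junction, where the next walk starts at [pa x l p]. *)
rewrite leq_eqVlt ltnNge ip orbF => /eqP pE.
by rewrite -pE subnn walk0 pE; exact: par.
Qed.

(** Up to the first letter where the words differ the walks agree, so the two differing paths leave
    from the same point and their ends are related by [r]. *)
Lemma walk_sep (r : T -> T -> Prop) :
  (forall x l l', l != l' -> r (pa x l p) (pa x l' p)) ->
  forall w w' x, size w = size w' -> w != w' ->
  exists2 i, (i <= size w * p)%N & r (walk p pa w x i) (walk p pa w' x i).
Proof.
move=> par; elim=> [|l w IH] [|l' w'] x //= [sw].
have [<-|ll' _] := eqVneq l l'.
  rewrite eqseq_cons eqxx /= => /(IH _ (pa x l p) sw)[i iw ri].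
  by exists (p + i)%N; rewrite ?mulSn ?leq_add2l// ltnNge leq_addr /= addKn.
by exists p; rewrite ?mulSn ?leq_addr// ltnn subnn !walk0; exact: par.
Qed.

End walks.

(** * Counting separated orbits *)

Section separated_orbits.
Context {R : realType}.
Local Notation I := (unitI R).
Implicit Types f g : I -> I.

Lemma mdist_unitI (x y : I) : mdist x y = `|val x - val y|.
Proof. by rewrite distrC. Qed.

Lemma iter_continuous f a : continuous f -> continuous (iter a f).
Proof.
move=> fC; elim: a => [|a IH] x /=; first exact: cvg_id.
by apply: (@continuous_comp _ _ _ (iter a f) f); [exact: IH|exact: fC].
Qed.

Lemma laps_extend_id : laps (extend (@id I)) 1 0 1.
Proof.
exists 1 => //; left; split; rewrite ?ltr01//.
- by rewrite /extend to_unitIK// lexx ler01.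
- by rewrite /extend to_unitIK// lexx ler01.
- by move=> x y x0 xy y1; rewrite /extend !to_unitIK//; lra.
Qed.

Lemma laps_iter f m a : (0 < m)%N -> continuous f -> laps (extend f) m 0 1 ->
  laps (extend (iter a f)) (m ^ a) 0 1.
Proof.
move=> m0 fC fl; elim: a => [|a IH]; first exact: laps_extend_id.
rewrite expnSr (_ : iter a.+1 f = f \o iter a f)//.
by rewrite extend_comp; apply: laps_comp => //;
  exact/extend_continuous/iter_continuous.
Qed.

Section commuting.
Context (f g : I -> I) (n m : nat).
Hypotheses (m0 : (0 < m)%N) (n0 : (0 < n)%N) (fC : continuous f)
  (gC : continuous g) (fl : laps (extend f) m 0 1) (gl : laps (extend g) n 0 1).
Hypotheses (fg : forall z, f (g z) = g (f z))
  (lift : forall x y, f y = g x -> exists2 z, f z = x & g z = y).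

Lemma laps_iter_comp a b :
  laps (extend (iter a f \o iter b g)) (n ^ b * m ^ a) 0 1.
Proof.
rewrite extend_comp; apply: laps_comp; first by rewrite expn_gt0 m0.
- exact/extend_continuous/iter_continuous.
- exact: laps_iter.
- exact: laps_iter.
Qed.

(** With [H] the sum of the variations, the integer part of [H / e] at the base point tells
    separated orbits apart; the final 1 accounts for the value 0 of this integer part. *)
Lemma separated_orbits_le k (e : R) (s : seq (k.+1.-tuple I)) : 0 < e -> uniq s ->
  (forall x, x \in s -> Orb (set_inv_comp f g) x) ->
  (forall x y, x \in s -> y \in s -> x != y ->
     exists i, e < mdist (tnth x i) (tnth y i)) ->
  (size s)%:R <= k.+1%:R * (maxn n m)%:R ^+ k / e + 1.
Proof.
move=> e0 us so ssep.
have /choice[z zP] : forall x : k.+1.-tuple I, exists z : I, x \in s ->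
    forall i : 'I_k.+1, tnth x i = iter (k - i) f (iter i g z).
  move=> x; have [xs|] := boolP (x \in s); last by exists (tnth x ord0).
  have [i ik|z zP] := @orbit_iter _ f g lift k (fun i => tnth x (inord i)).
    by apply: (so x xs); rewrite !inordK// ltnS// ltnW.
  by exists z => _ i; rewrite -zP ?inord_val// -ltnS.
have /choice[h hP] := fun i : 'I_k.+1 => laps_variation (laps_iter_comp (k - i) i).
pose H x := \sum_(i < k.+1) h i x.
have B : \sum_(i < k.+1) (n ^ i * m ^ (k - i))%:R <= k.+1%:R * (maxn n m)%:R ^+
  k :> R.
  rewrite -[k.+1 in leRHS]card_ord mulr_natl -sumr_const.
  apply: ler_sum => i _; rewrite -natrX ler_nat.
  have ik : (i <= k)%N by rewrite -ltnS.
  have -> : (maxn n m ^ k = maxn n m ^ i * maxn n m ^ (k - i))%N.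
    by rewrite -expnD subnKC.
  have exp_le a b c : (a <= b -> a ^ c <= b ^ c)%N.
    by case: c => // c ab; rewrite leq_exp2r.
  by rewrite leq_mul// exp_le// ?leq_maxl ?leq_maxr.
have H0 x : 0 <= H x.
  by apply: sumr_ge0 => i _; have [_ /(_ x)/andP[]] := hP i.
have HB x : H x <= k.+1%:R * (maxn n m)%:R ^+ k.
  by apply: le_trans B; apply: ler_sum => i _; have [_ /(_ x)/andP[]] := hP i.
pose t x := Num.trunc (H (val (z x)) / e).
have tlt x y : x \in s -> y \in s -> val (z x) <= val (z y) -> t x = t y -> x = y.
  move=> xs ys zxy txy; apply/eqP/negPn/negP => /(ssep _ _ xs ys)[i].
  apply/negP; rewrite -leNgt mdist_unitI !zP//.
  have /andP[zx0 _] := val_unitI (z x); have /andP[_ zy1] := val_unitI (z y).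
  have [_ _ /(_ _ _ zx0 zxy zy1)] := hP i; rewrite !extend_val => /le_trans; apply.
  (* All summands are nondecreasing, so a single one increases by no more than the sum. *)
  have : h i (val (z y)) - h i (val (z x)) <= H (val (z y)) - H (val (z x)).
    rewrite /H -sumrB (bigD1 i)//= lerDl sumr_ge0// => j _.
    by have [hj _ _] := hP j; rewrite subr_ge0 hj.
  move/le_trans; apply.
  have /truncn_itv/andP[tx _] : 0 <= H (val (z x)) / e by rewrite divr_ge0 ?H0 ?ltW.
  have /truncn_itv/andP[_ ty] : 0 <= H (val (z y)) / e by rewrite divr_ge0 ?H0 ?ltW.
  have : H (val (z y)) / e - H (val (z x)) / e <= 1.
    by move: tx ty; rewrite -/(t x) -/(t y) txy -natr1; lra.
  by rewrite -mulrBl ler_pdivrMr// mul1r.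
have tinj : {in s &, injective t}.
  move=> x y xs ys txy; have [zxy|zyx] := leP (val (z x)) (val (z y));
    first exact: tlt.
  by apply/esym/tlt => //; exact: ltW.
have : (size (map t s) <= size (iota 0 (Num.trunc (k.+1%:R * (maxn n m)%:R ^+ k
  / e)).+1))%N.
  apply: uniq_leq_size; first by rewrite map_inj_in_uniq.
  move=> _ /mapP[x _ ->]; rewrite mem_iota /= add0n ltnS.
  by apply: le_truncn; rewrite ler_pM2r ?invr_gt0.
rewrite size_map size_iota -(ler_nat R) => /le_trans; apply.
have /truncn_itv/andP[b _] : 0 <= k.+1%:R * (maxn n m)%:R ^+ k / e.
  by rewrite divr_ge0 ?(ltW e0)// mulr_ge0// exprn_ge0.
by rewrite -natr1 lerD2r.
Qed.

(** A label picks a point of the fibre of f^p over g^p x, and [iter_path] leads there from [x]. The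
    orbits are the walks along words of [q] labels. The scale [e] comes from the laps of f^p, so it
    does not depend on [q]. *)
Lemma separated_orbits_ge p : (0 < p)%N -> exists2 e : R, 0 < e &
  forall q, exists o : q.-tuple 'I_((m ^ p)./2) -> nat -> I,
    (forall t i, (i < q * p)%N -> f (o t i.+1) = g (o t i)) /\
    (forall s t, s != t -> exists2 i, (i <= q * p)%N &
       e < mdist (o s i) (o t i)).
Proof.
move=> p0; have fpC : continuous (extend (iter p f)).
  exact/extend_continuous/iter_continuous.
have [e e0 he] := laps_fiber fpC (laps_iter p m0 fC fl); exists e => // q.
set N := (m ^ p)./2.
have /choice[pa paP] : forall x : I, exists pa : 'I_N -> nat -> I,
    (forall l, [/\ pa l 0%N = x & forall i,
      (i < p)%N -> f (pa l i.+1) = g (pa l i)]) /\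
    (forall l l', l != l' -> e < mdist (pa l p) (pa l' p)).
  move=> x; have [s [ss s01 sv sp]] := he (val (iter p g x)) (val_unitI _).
  pose y (l : 'I_N) := to_unitI (nth 0 s l).
  have ls (l : 'I_N) : nth 0 s l \in s by rewrite mem_nth// ss.
  have yE l : val (y l) = nth 0 s l by rewrite to_unitIK// s01.
  have /choice[pa paP] : forall l, exists o : nat -> I,
    [/\ o 0%N = x, o p = y l & forall i, (i < p)%N -> f (o i.+1) = g (o i)].
    move=> l; apply: iter_path => //; apply: val_inj.
    by rewrite -[LHS]extend_val yE sv.
  exists pa; split=> [l|l l' ll']; first by have [] := paP l.
  have [_ -> _] := paP l; have [_ -> _] := paP l'.
  rewrite mdist_unitI !yE; move/(pairwiseP 0): sp => sp.
  have [lt|lt|/val_inj lt] := ltngtP l l'.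
  - by apply: sp => //; rewrite inE ss.
  - by rewrite distrC; apply: sp => //; rewrite inE ss.
  - by rewrite lt eqxx in ll'.
(* All walks start at the same point, as [walk_sep] requires; 0 is an arbitrary choice. *)
exists (fun t => walk p pa t (to_unitI 0)); split=> [t i iqp|s t st].
  apply: (@walk_step _ _ p pa p0 _ (fun a b => f b = g a)).
  - by move=> x l; have [/(_ l)[]] := paP x.
  - by move=> x l j jp; have [/(_ l)[_ /(_ j jp)]] := paP x.
  - by rewrite size_tuple.
have := @walk_sep _ _ p pa p0 _ (fun a b => e < mdist a b) _ s t (to_unitI 0).
rewrite !size_tuple; apply => //.
- by move=> x l; have [/(_ l)[]] := paP x.
- by move=> x l l' ll'; have [_ /(_ l l' ll')] := paP x.
Qed.

End commuting.
End separated_orbits.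

(** * Exponential growth rates and the entropy formula *)

Section entropy_estimates.
Context {R : realType}.
Local Notation I := (unitI R).

Lemma sep_card_growth (f g : I -> I) (n m : nat) (e d : R) :
  (0 < m)%N -> (0 < n)%N -> continuous f -> continuous g ->
  laps (extend f) m 0 1 -> laps (extend g) n 0 1 ->
  (forall x y, f y = g x -> exists2 z, f z = x & g z = y) ->
  0 < e -> 0 < d -> exists2 C, 0 < C & forall k,
  (sep_card (set_inv_comp f g) k e
     <= (C * expR ((ln (maxn n m)%:R + d) * k%:R))%:E)%E.
Proof.
move=> m0 n0 fC gC fl gl lift e0 d0.
set M : R := (maxn n m)%:R.
have M1 : 1 <= M by rewrite ler1n leq_max n0.
have M0 : 0 < M by exact: lt_le_trans M1.
have L0 : 0 <= ln M by exact: ln_ge0.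
(* The first term comes from bounding [k] by exp(d k) / d, the second from the additive 1 in
   [separated_orbits_le]. *)
exists ((e * d)^-1 + 1) => [|k].
  by rewrite ltr_wpDl// invr_ge0 mulr_ge0 ?ltW.
have E1 : 1 <= expR ((ln M + d) * k%:R) by rewrite -expR0 ler_expR mulr_ge0//
  addr_ge0// ltW.
apply: sep_card_le => s us so ssep.
have {us so ssep} : (size s)%:R <= k%:R * M ^+ k / e + 1.
  (* For length 0 there is only the empty tuple. For length [k.+1] the exponent [k] is raised to
     [k.+1] using [1 <= M]. *)
  case: k s us so ssep {E1} => [|k] s us so ssep.
    rewrite !mul0r add0r lern1 leqNgt; apply/negP.
    case: s us {so ssep} => [//|x [//|y s]] /=.
    by rewrite (tuple0 x) (tuple0 y) mem_head.
  apply: le_trans (separated_orbits_le m0 n0 fC gC fl gl lift e0 us so ssep) _.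
  by rewrite lerD2r ler_pM2r ?invr_gt0// ler_pM2l// exprS ler_peMl// exprn_ge0//
    ltW.
move/le_trans; apply; rewrite mulrDl mul1r lerD//.
have -> : expR ((ln M + d) * k%:R) = M ^+ k * expR (d * k%:R).
  by rewrite mulrDl expRD -[in RHS](lnK M0) -expRM_natl [k%:R * _]mulrC.
have kd : k%:R <= d^-1 * expR (d * k%:R).
  rewrite ler_pdivlMl//; apply: le_trans (expR_ge1Dx _); lra.
rewrite invfM mulrC -mulrA ler_pM2l ?invr_gt0// mulrC mulrCA ler_pM2l ?exprn_gt0//.
Qed.

(** The two alternatives for [F] allow the orbits of the pair to be read forwards or backwards, so
    that either map can play the role of [f]. *)
Lemma sep_card_exponential (f g : I -> I) (m : nat) (F : I -> set I) (d : R) :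
  (1 < m)%N -> continuous f -> laps (extend f) m 0 1 ->
  (forall z, f (g z) = g (f z)) ->
  (forall x y, f y = g x -> exists2 z, f z = x & g z = y) ->
  (forall x y, f y = g x -> F x y) \/ (forall x y, f x = g y -> F x y) ->
  0 < d -> exists2 e, 0 < e & forall N, exists2 k, (N <= k)%N &
  ((expR ((ln m%:R - d) * k%:R))%:E <= sep_card F k e)%E.
Proof.
move=> m1 fC fl fg lift FP d0.
have m0 : (0 < m)%N by exact: ltnW.
have A0 : 0 <= ln m%:R :> R by rewrite ln_ge0// ler1n.
have B0 : 0 <= ln 4 :> R by rewrite ln_ge0// ler1n.
(* Each block of [p] steps loses at most ln 4 through the halving of m^p, and the orbit has one
   point beyond its [q * p] steps, costing ln m once. Blocks this long keep the total loss below [d]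
   per step. *)
pose p := (Num.trunc ((ln m%:R + ln 4) / d)).+1.
have hp : ln m%:R + ln 4 <= p%:R * d.
  by rewrite -ler_pdivrMr// ltW// truncnS_gt.
have [e e0 ho] := @separated_orbits_ge R f g m m0 fC fl fg lift p (ltn0Sn _).
exists e => // N; pose q := N.+1; have [w [wP wsep]] := ho q.
have Nk : (N <= (q * p).+1)%N by rewrite leqW// (leq_trans (leqnSn N))// leq_pmulr.
exists (q * p).+1 => //.
set W := (m ^ p)./2 in w wP wsep.
(* Since m^p is at least 2, rounding its half down leaves at least a quarter. *)
have W4 : m%:R ^+ p / 4 <= W%:R :> R.
  have W2 : (2 <= m ^ p)%N by rewrite (leq_trans m1)// -{1}(expn1 m) leq_pexp2l.
  rewrite ler_pdivrMr// -natrX -natrM ler_nat.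
  by have := odd_double_half (m ^ p); rewrite -/W; lia.
have W0 : 0 < W%:R :> R by apply: lt_le_trans W4;
  rewrite divr_gt0// exprn_gt0// ltr0n.
have lnW : ln m%:R * p%:R - ln 4 <= ln W%:R :> R.
  have mp0 : 0 < m%:R ^+ p :> R by rewrite exprn_gt0// ltr0n.
  apply: (@le_trans _ _ (ln (m%:R ^+ p / 4))); last first.
    by rewrite ler_ln ?posrE// divr_gt0.
  by rewrite lnM ?posrE ?invr_gt0// lnV ?posrE// lnXn ?ltr0n// mulr_natr.
apply: (@le_trans _ _ (#|{: q.-tuple 'I_W}|%:R)%:E).
  rewrite card_tuple card_ord natrX lee_fin -[leRHS]lnK ?posrE ?exprn_gt0//.
  rewrite ler_expR lnXn// -[leRHS]mulr_natr -natr1 natrM.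
  have q1 : 1 <= q%:R :> R by rewrite ler1n.
  have : (ln m%:R * p%:R - ln 4) * q%:R <= ln W%:R * q%:R :> R by rewrite
    ler_pM2r// ltr0n.
  have : (ln m%:R + ln 4) * q%:R <= p%:R * d * q%:R by rewrite ler_pM2r// ltr0n.
  have : ln m%:R * 1 <= ln m%:R * q%:R :> R by exact: ler_wpM2l.
  by lra.
have [FP'|FP'] := FP.
  apply: (@le_sep_card _ _ _ _ _ _ (fun t => w t)); first exact: ltW.
    by move=> t i; rewrite ltnS => iqp; apply/FP'/wP.
  by move=> s t /wsep[i iqp ei]; exists i.
apply: (@le_sep_card _ _ _ _ _ _ (fun t i => w t (q * p - i)%N)); first exact: ltW.
  move=> t i; rewrite ltnS => iqp; apply/FP'; rewrite -(subnSK iqp); apply: wP.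
  by rewrite subnSK// leq_subr.
by move=> s t /wsep[i iqp ei]; exists (q * p - i)%N; rewrite ?ltnS ?leq_subr ?subKn.
Qed.

End entropy_estimates.

Theorem theorem4p20 (R : realType) (n m : nat) (hn : (2 <= n)%N)
    (hm : (2 <= m)%N) (Fn Fm : unitI R -> unitI R)
    (Fn_pm : piecewise_monotone Fn) (Fn_open : open_map Fn)
    (Fn_crit : (critical Fn #= `I_n.-1)%card)
    (Fm_pm : piecewise_monotone Fm) (Fm_open : open_map Fm)
    (Fm_crit : (critical Fm #= `I_m.-1)%card)
    (Fnm_comm : set_comp_inv Fn Fm = set_inv_comp Fm Fn) :
  Ent (set_comp_inv Fn Fm) = (Num.max (ln n%:R) (ln m%:R))%:E.
Proof.
have [nC _] := Fn_pm; have [mC _] := Fm_pm.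
have n0 := ltnW hn; have m0 := ltnW hm.
have nl := open_map_laps nC Fn_open n0 Fn_crit.
have ml := open_map_laps mC Fm_open m0 Fm_crit.
(* One inclusion between the two set-valued maps is commutation, the other is the lifting
   property. *)
have comm z : Fm (Fn z) = Fn (Fm z).
  have : set_comp_inv Fn Fm (Fm z) (Fn z) by exists z.
  by rewrite Fnm_comm.
have lift x y : Fm y = Fn x -> exists2 z, Fm z = x & Fn z = y.
  move=> yx; have : set_inv_comp Fm Fn x y by [].
  by rewrite -Fnm_comm => -[z zx zy]; exists z.
have lift' x y : Fn y = Fm x -> exists2 z, Fn z = x & Fm z = y.
  by move=> /esym/lift[z]; exists z.
have maxE : Num.max (ln n%:R) (ln m%:R) = ln (maxn n m)%:R :> R.
  have ln_le a b : (0 < a)%N -> (a <= b)%N -> ln a%:R <= ln b%:R :> R.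
    by move=> a0 ab; rewrite ler_ln ?posrE ?ltr0n ?ler_nat// (leq_trans a0).
  by case: (leqP n m) => nm; [apply/max_idPr|apply/max_idPl]; apply:
    ln_le => //; exact: ltnW.
rewrite Fnm_comm; apply: Ent_eq => [e e0 d d0|d d0].
  by rewrite maxE; exact: sep_card_growth.
(* The map with more laps supplies the fibres; if it is [Fn], the orbits are read backwards. *)
rewrite maxE; case: (leqP n m) => nm.
  by apply: (@sep_card_exponential _ Fm Fn) => //; left.
apply: (@sep_card_exponential _ Fn Fm) => //; right => x y xy.
by rewrite /set_inv_comp /= xy.
Qed.
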